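(* Let $R$ be a commutative ring and let $T(R)$ be its total ring of fractions. Then $|R| = |T(R)|$.
   Context: We work in ZFC; $|X|$ denotes the cardinality of a set $X$. Rings have an identity. The total ring of fractions $T(R)$ is the localization $S^{-1}R$ where $S$ is the multiplicative set of all non-zero-divisors of $R$. *)

(* Defs.v *)
From HB Require Import structures.
From mathcomp Require Import all_boot all_algebra generic_quotient.
From mathcomp Require Import boolp classical_sets functions cardinality.
From mathcomp Require Import ring.

Set Implicit Arguments.
Unset Strict Implicit.
Unset Printing Implicit Defensive.

Import GRing.Theory.
Local Open Scope ring_scope.
Local Open Scope quotient_scope.

(* [{fraction R}] is only available for integral domains, so localizations of
   arbitrary commutative rings (zero ring and zero divisors allowed) are built
   here. *)
Module Localization.
Section Localization.
Variables (R : comPzRingType) (S : mulrClosed R).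

Definition preloc : Type := R * {s : R | s \in S}.
HB.instance Definition _ := Choice.on preloc.
Implicit Types x y z : preloc.

Definition num x : R := x.1.
Definition den x : R := sval x.2.

Local Ltac loc_ring :=
  rewrite /num /den; repeat (progress rewrite /num /den /=); ring.

Lemma den_in x : den x \in S. Proof. exact: (svalP x.2). Qed.

(* The factor [t] is what makes this relation transitive when [S] contains
   zero divisors. *)
Definition eqv x y : bool :=
  `[< exists2 t, t \in S & t * (num x * den y - num y * den x) = 0 >].

Lemma eqvP x y :
  reflect (exists2 t, t \in S & t * (num x * den y - num y * den x) = 0)
          (eqv x y).
Proof. exact: asboolP. Qed.

Lemma eqv_refl : reflexive eqv.
Proof. by move=> x; apply/eqvP; exists 1; rewrite ?rpred1 // subrr mulr0. Qed.

Lemma eqv_symm x y : eqv x y -> eqv y x.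
Proof.
move=> /eqvP[t tS e]; apply/eqvP; exists t => //.
by rewrite -opprB mulrN e oppr0.
Qed.

Lemma eqv_sym : symmetric eqv.
Proof. by move=> x y; apply/idP/idP; exact: eqv_symm. Qed.

Lemma eqv_trans : transitive eqv.
Proof.
move=> y x z /eqvP[t tS e] /eqvP[u uS f]; apply/eqvP.
exists (t * u * den y); first by rewrite !rpredM ?den_in.
transitivity (u * den z * (t * (num x * den y - num y * den x))
            + t * den x * (u * (num y * den z - num z * den y))); first by ring.
by rewrite e f !mulr0 addr0.
Qed.

Canonical eqv_equiv := EquivRel eqv eqv_refl eqv_sym eqv_trans.

Definition type : Type := {eq_quot eqv}.
HB.instance Definition _ : EqQuotient _ eqv type := EqQuotient.on type.
HB.instance Definition _ := Choice.on type.

Definition mk (r s : R) (sS : s \in S) : preloc := (r, exist _ s sS).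
Definition frac (r s : R) (sS : s \in S) : type := \pi_type (mk r sS).

Lemma pi_eqv x y : eqv x y -> \pi_type x = \pi_type y.
Proof. by move=> e; apply/eqmodP. Qed.

Lemma eqv_repr x : eqv (repr (\pi_type x)) x.
Proof. by apply/eqmodP; rewrite reprK. Qed.

Definition add0 x y : preloc :=
  mk (num x * den y + num y * den x) (rpredM (den_in x) (den_in y)).
Definition opp0 x : preloc := mk (- num x) (den_in x).
Definition mul0 x y : preloc :=
  mk (num x * num y) (rpredM (den_in x) (den_in y)).

Definition add (a b : type) : type := \pi_type (add0 (repr a) (repr b)).
Definition opp (a : type) : type := \pi_type (opp0 (repr a)).
Definition mul (a b : type) : type := \pi_type (mul0 (repr a) (repr b)).
Definition zero : type := frac 0 (rpred1 S).
Definition one : type := frac 1 (rpred1 S).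

Lemma pi_add x y : add (\pi x) (\pi y) = \pi_type (add0 x y).
Proof.
apply: pi_eqv; apply/eqvP.
have /eqvP[t tS e] := eqv_repr x; have /eqvP[u uS f] := eqv_repr y.
move: (repr (\pi x)) (repr (\pi y)) e f => x' y' e f.
exists (t * u); first by rewrite rpredM.
transitivity (u * den y * den y' * (t * (num x' * den x - num x * den x'))
            + t * den x * den x' * (u * (num y' * den y - num y * den y')));
  first by loc_ring.
by rewrite e f !mulr0 addr0.
Qed.

Lemma pi_opp x : opp (\pi x) = \pi_type (opp0 x).
Proof.
apply: pi_eqv; apply/eqvP; have /eqvP[t tS e] := eqv_repr x.
move: (repr (\pi x)) e => x' e; exists t => //.
transitivity (- (t * (num x' * den x - num x * den x'))); first by loc_ring.
by rewrite e oppr0.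
Qed.

Lemma pi_mul x y : mul (\pi x) (\pi y) = \pi_type (mul0 x y).
Proof.
apply: pi_eqv; apply/eqvP.
have /eqvP[t tS e] := eqv_repr x; have /eqvP[u uS f] := eqv_repr y.
move: (repr (\pi x)) (repr (\pi y)) e f => x' y' e f.
exists (t * u); first by rewrite rpredM.
transitivity (u * num y' * den y * (t * (num x' * den x - num x * den x'))
            + t * num x * den x' * (u * (num y' * den y - num y * den y')));
  first by loc_ring.
by rewrite e f !mulr0 addr0.
Qed.

Lemma pi_cross x y : num x * den y = num y * den x -> \pi_type x = \pi_type y.
Proof.
move=> e; apply/pi_eqv/eqvP; exists 1; first exact: rpred1.
by rewrite e subrr mulr0.
Qed.

Lemma addA : associative add.
Proof.
elim/quotW=> x; elim/quotW=> y; elim/quotW=> z; rewrite !pi_add.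
by apply: pi_cross; loc_ring.
Qed.

Lemma addC : commutative add.
Proof.
elim/quotW=> x; elim/quotW=> y; rewrite !pi_add.
by apply: pi_cross; loc_ring.
Qed.

Lemma add0l : left_id zero add.
Proof.
elim/quotW=> x; rewrite pi_add.
by apply: pi_cross; loc_ring.
Qed.

Lemma addNl : left_inverse zero opp add.
Proof.
elim/quotW=> x; rewrite pi_opp pi_add.
by apply: pi_cross; loc_ring.
Qed.

HB.instance Definition _ := GRing.isZmodule.Build type addA addC add0l addNl.

Lemma mulA : associative mul.
Proof.
elim/quotW=> x; elim/quotW=> y; elim/quotW=> z; rewrite !pi_mul.
by apply: pi_cross; loc_ring.
Qed.

Lemma mulC : commutative mul.
Proof.
elim/quotW=> x; elim/quotW=> y; rewrite !pi_mul.
by apply: pi_cross; loc_ring.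
Qed.

Lemma mul1l : left_id one mul.
Proof.
elim/quotW=> x; rewrite pi_mul.
by apply: pi_cross; loc_ring.
Qed.

Lemma mulDl : left_distributive mul add.
Proof.
elim/quotW=> x; elim/quotW=> y; elim/quotW=> z; rewrite !(pi_add, pi_mul).
by apply: pi_cross; loc_ring.
Qed.

HB.instance Definition _ :=
  GRing.Zmodule_isComPzRing.Build type mulA mulC mul1l mulDl.

Definition tofrac (r : R) : type := frac r (rpred1 S).

Lemma tofrac_is_zmod_morphism : zmod_morphism tofrac.
Proof.
move=> r s; rewrite -[RHS]/(add _ (opp _)) pi_opp pi_add.
by apply: pi_cross; loc_ring.
Qed.
HB.instance Definition _ :=
  GRing.isZmodMorphism.Build R type tofrac tofrac_is_zmod_morphism.

Lemma tofrac_is_monoid_morphism : monoid_morphism tofrac.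
Proof.
split=> // r s; rewrite -[RHS]/(mul _ _) pi_mul.
by apply: pi_cross; loc_ring.
Qed.
HB.instance Definition _ :=
  GRing.isMonoidMorphism.Build R type tofrac tofrac_is_monoid_morphism.

Lemma fracP (a : type) : exists r s (sS : s \in S), a = frac r sS.
Proof. by elim/quotW: a => -[r [s sS]]; exists r, s, sS. Qed.

Lemma frac_eq (r s r' s' : R) (sS : s \in S) (s'S : s' \in S) :
  frac r sS = frac r' s'S <->
  exists2 t, t \in S & t * (r * s' - r' * s) = 0.
Proof. by split=> [/eqmodP/eqvP|e]; last exact/pi_eqv/eqvP. Qed.

Lemma mul_frac (r s : R) (sS : s \in S) : frac r sS * tofrac s = tofrac r.
Proof.
rewrite -[LHS]/(mul _ _) pi_mul.
by apply: pi_cross; loc_ring.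
Qed.

Lemma tofrac_unit (s : R) (sS : s \in S) : frac 1 sS * tofrac s = 1.
Proof. by rewrite mul_frac rmorph1. Qed.

End Localization.
End Localization.
HB.export Localization.

Notation localization := Localization.type.

Section TotalFractions.
Variable R : comPzRingType.

Definition non_zero_divisor : {pred R} :=
  fun x => `[< forall y : R, x * y = 0 -> y = 0 >].

Lemma non_zero_divisorP (x : R) :
  reflect (forall y, x * y = 0 -> y = 0) (x \in non_zero_divisor).
Proof. exact: asboolP. Qed.

Lemma non_zero_divisor_mulr_closed : mulr_closed non_zero_divisor.
Proof.
split=> [|x y /non_zero_divisorP xP /non_zero_divisorP yP];
  apply/non_zero_divisorP => z; first by rewrite mul1r.
by rewrite -mulrA => /xP/yP.
Qed.
HB.instance Definition _ :=
  GRing.isMulClosed.Build R non_zero_divisor non_zero_divisor_mulr_closed.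

End TotalFractions.

Definition total_fractions (R : comPzRingType) : comPzRingType :=
  localization (@non_zero_divisor R).

(* Main.v *)
(** [R] embeds in [T(R)] because denominators are regular.  If [R] is finite,
    two powers of a regular element coincide, so it is invertible and the
    embedding is onto.  If [R] is infinite, a fraction is determined by a pair
    of elements of [R], and [|R * R| = |R|] by Hessenberg's theorem.

    For the latter, take by Zorn's lemma a maximal injection
    [f : A * A -> A] with [A] infinite.  If the complement of [A] embeds in
    [A], then [T] embeds in two copies of [A], hence in [A * A] and in [A], and
    we are done.  Otherwise [A] embeds in its complement, say onto [B]; then
    [(A U B) * (A U B)] embeds in [A * A], hence in [B], which makes it
    possible to extend [f] to [A U B]. *)
Require Import Defs.
From mathcomp Require Import all_boot all_algebra generic_quotient.
From mathcomp Require Import boolp classical_sets functions cardinality.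

Import GRing.Theory.

Local Open Scope classical_set_scope.
Local Open Scope card_scope.

(** * Comparability of cardinals *)

Lemma card_le_total {T U : pointedType} (A : set T) (B : set U) :
  A #<= B \/ B #<= A.
Proof.
(* The equivalence makes the graph [G] single-valued and injective at once. *)
pose P (G : set (T * U)) := G `<=` A `*` B /\
  forall p q, G p -> G q -> p.1 = q.1 <-> p.2 = q.2.
have [F FP Ftot|G [[GAB Ginj] Gmax]] := @Zorn_bigcup _ P.
  split=> [p [X FX]|p q [X FX Xp] [Y FY Yq]]; first by apply: (FP _ FX).1.
  have [XY|YX] := Ftot _ _ FX FY.
    exact: (FP _ FY).2 (XY _ Xp) Yq.
  exact: (FP _ FX).2 Xp (YX _ Yq).
have [domG|ndom] := pselect (forall x, A x -> exists y, G (x, y)).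
  left; apply/pcard_leP; apply/injfunPex.
  exists (fun x => xget point [set y | G (x, y)]).
    by move=> x /domG[y Gxy]; case: xgetP => [_ _ /GAB[]//|/(_ y)].
  move=> x x' /set_mem/domG[y Gxy] /set_mem/domG[y' Gxy'].
  case: xgetP => [z _ Gz|/(_ y)//]; case: xgetP => [z' _ Gz'|/(_ y')//].
  by move=> /(Ginj (x, z) (x', z') Gz Gz').
have [ranG|nran] := pselect (forall y, B y -> exists x, G (x, y)).
  right; apply/pcard_leP; apply/injfunPex.
  exists (fun y => xget point [set x | G (x, y)]).
    by move=> y /ranG[x Gxy]; case: xgetP => [_ _ /GAB[]//|/(_ x)].
  move=> y y' /set_mem/ranG[x Gxy] /set_mem/ranG[x' Gxy'].
  case: xgetP => [z _ Gz|/(_ x)//]; case: xgetP => [z' _ Gz'|/(_ x')//].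
  by move=> /(Ginj (z, y) (z', y') Gz Gz').
move: ndom nran => /existsNP[x /not_implyP[Ax /forallNP Gx]].
move=> /existsNP[y /not_implyP[By /forallNP Gy]].
(* [x] is outside the domain and [y] outside the range, so adding [(x, y)] contradicts
   maximality. *)
case: (Gmax (G `|` [set (x, y)])).
  split=> [|GG]; first exact: subsetUl.
  by apply: (Gx y); apply: GG; right.
split=> [p [/GAB//|->]//|[u v] [u' v']].
move=> [Guv|[-> ->]] [Guv'|[-> ->]] //=.
- exact: Ginj Guv Guv'.
- by split=> e; move: Guv; rewrite e; move=> /Gx || move=> /Gy.
- by split=> e; move: Guv'; rewrite -e; move=> /Gx || move=> /Gy.
Qed.

Lemma card_le_range {T U : Type} {f : T -> U} :
  injective f -> [set: T] #<= range f.
Proof.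
move=> finj; have /card_eqPle[] // : range f #= [set: T].
by apply: inj_card_eq => x y _ _; apply: finj.
Qed.

Lemma injective_card_le {T U : Type} {f : T -> U} :
  injective f -> [set: T] #<= [set: U].
Proof. by move=> /card_le_range/card_le_trans; apply; apply: card_leT. Qed.

(** * Hessenberg's theorem *)

Definition square_inj {T : Type} (A : set T) (f : T * T -> T) :=
  set_fun (A `*` A) A f /\ set_inj (A `*` A) f.

Lemma square_inj_eq {T : Type} {A : set T} {f : T * T -> T} {x y x' y' : T} :
  square_inj A f -> A x -> A y -> A x' -> A y' ->
  f (x, y) = f (x', y') -> x = x' /\ y = y'.
Proof.
move=> [_ finj] Ax Ay Ax' Ay' /finj; rewrite !inE.
by move=> /(_ (conj Ax Ay) (conj Ax' Ay'))[-> ->].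
Qed.

Lemma infinite_set_neq {T : Type} (A : set T) : infinite_set A ->
  exists a b, [/\ A a, A b & a <> b].
Proof.
move=> Ainf; have [a Aa] := infinite_setN0 Ainf.
have [[b [Ab /= ba]]|nex] := pselect (A `\` [set a] !=set0).
  by exists a, b; split=> // ab; apply: ba.
case: Ainf; apply: (sub_finite_set _ (finite_set1 a)) => x Ax.
by apply: contrapT => xa; apply: nex; exists x.
Qed.

(* [D] is contained in two disjoint copies of [A], and these fit in [A * A]. *)
Lemma square_inj_absorb {T : pointedType} {A D : set T} {f : T * T -> T} :
  square_inj A f -> infinite_set A -> D `\` A #<= A -> D #<= A.
Proof.
move=> fA /infinite_set_neq[a [b [Aa Ab ab]]] /pcard_leP/injfunPex[g gA ginj].
apply/pcard_leP/injfunPex.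
exists (fun x => if x \in A then f (x, a) else f (g x, b)).
  move=> x Dx /=; case: ifPn; rewrite ?inE ?notin_setE => Ax; apply: fA.1 => //.
  by split=> //=; apply: gA.
move=> x y /set_mem Dx /set_mem Dy /=.
case: ifPn => Ax; case: ifPn => Ay; rewrite ?inE ?notin_setE in Ax Ay.
- by move=> /(square_inj_eq fA)[].
- by move=> /(square_inj_eq fA)[]//; apply: gA.
- by move=> /(square_inj_eq fA)[]// => [|_ /esym]; first exact: gA.
- move=> /(square_inj_eq fA)[]//; try exact: gA.
  by move=> gxy _; apply: ginj; rewrite ?inE.
Qed.

Lemma square_inj_extend {T : pointedType} {A : set T} {f : T * T -> T} :
  square_inj A f -> infinite_set A -> A #<= ~` A ->
  exists C f', [/\ A `<` C, square_inj C f' &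
    forall x y, A x -> A y -> f' (x, y) = f (x, y)].
Proof.
move=> fA Ainf /pcard_leP/injfunPex[g gA ginj].
have : (A `|` g @` A) #<= A.
  apply: (square_inj_absorb fA Ainf); apply: card_le_trans (card_image_le g A).
  by apply: subset_card_le => x [[]].
move=> /pcard_leP/injfunPex[h hA hinj].
(* Off [A * A], a pair is sent by [h] into [A * A], coded by [f] in [A], then moved by [g] out of
   [A]; hence the two branches never share a value. *)
exists (A `|` g @` A),
  (fun p => if p \in A `*` A then f p else g (f (h p.1, h p.2))).
have [a Aa] := infinite_setN0 Ainf.
have fhA x y : (A `|` g @` A) x -> (A `|` g @` A) y -> A (f (h x, h y)).
  by move=> Cx Cy; apply: fA.1; split; apply: hA.
split.
- split; first exact: subsetUl.
  move=> /(_ (g a)) /= CA; apply: (gA _ Aa); apply: CA.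
  by right; exists a.
- split=> [p [C1 C2] /=|p q /set_mem[p1 p2] /set_mem[q1 q2]].
    case: ifPn => [/set_mem Ap|_]; first by left; apply: fA.1.
    by right; exists (f (h p.1, h p.2)) => //; apply: fhA.
  case: ifPn => [/set_mem Ap|_]; case: ifPn => [/set_mem Aq|_].
  + by apply: fA.2; rewrite inE.
  + by move=> e; case: (gA _ (fhA _ _ q1 q2)); rewrite -e; apply: fA.1.
  + by move=> e; case: (gA _ (fhA _ _ p1 p2)); rewrite e; apply: fA.1.
  + move=> /ginj; rewrite !inE => /(_ (fhA _ _ p1 p2) (fhA _ _ q1 q2)).
    move=> /(square_inj_eq fA)[]; try exact: hA.
    move=> /hinj; rewrite !inE => /(_ p1 q1) e1.
    move=> /hinj; rewrite !inE => /(_ p2 q2) e2.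
    by case: p q {p1 p2 q1 q2} e1 e2 => [? ?] [? ?] /= -> ->.
- by move=> x y Ax Ay; rewrite ifT// inE.
Qed.

(** Seed for Zorn's lemma: a countably infinite subset inherits the pairing [pickle] of the natural
    numbers. *)
Lemma infinite_square_inj {T : pointedType} : infinite_set [set: T] ->
  exists (A : set T) f, infinite_set A /\ square_inj A f.
Proof.
move=> /infiniteP/pcard_leP/injfunPex[i _ iinj].
have {}iinj : injective i by move=> m n /iinj; apply; rewrite inE.
pose j x := xget 0%N [set n | i n = x].
have ij n : j (i n) = n by rewrite /j; case: xgetP => [m _ /iinj//|/(_ n erefl)].
exists (range i), (fun p => i (pickle (j p.1, j p.2))); split.
  exact/infiniteP/card_le_range.
split=> [p _|[x y] [x' y'] /set_mem[/= [m _ <-] [n _ <-]]].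
  exact: imageT.
move=> /set_mem[/= [m' _ <-] [n' _ <-]]; rewrite !ij.
by move=> /iinj/(pcan_inj pickleK)[-> ->].
Qed.

Lemma maximal_square_inj {T : pointedType} : infinite_set [set: T] ->
  exists (A : set T) f, [/\ infinite_set A, square_inj A f &
    forall C f', A `<` C -> square_inj C f' ->
      ~ (forall x y, A x -> A y -> f' (x, y) = f (x, y))].
Proof.
move=> /infinite_square_inj[A0 [f0 A0f0]].
pose sq := {p : set T * (T * T -> T) | infinite_set p.1 /\ square_inj p.1 p.2}.
(* Values off the square of the carrier are ignored, so [ext] is only a preorder: distinct maps may
   extend each other. *)
pose ext (s t : sq) := (sval s).1 `<=` (sval t).1 /\
  forall x y, (sval s).1 x -> (sval s).1 y ->
    (sval t).2 (x, y) = (sval s).2 (x, y).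
pose t0 : sq := exist _ (A0, f0) A0f0.
have ext_trans s t u : ext s t -> ext t u -> ext s u.
  move=> [st fst] [tu ftu]; split; first exact: subset_trans tu.
  by move=> x y sx sy; rewrite ftu ?fst//; apply: st.
have [|r s t /asboolP rs /asboolP st||[[A f] [Ainf Af]] Amax] :=
    @ZL_preorder sq t0 (fun s t => `[< ext s t >]).
- by move=> t; apply/asboolP; split.
- exact/asboolP/ext_trans/st.
- move=> F Ftot.
  have [[s0 Fs0]|F0] := pselect (F !=set0); last first.
    by exists t0 => s Fs; case: F0; exists s.
  pose A := \bigcup_(s in F) (sval s).1.
  have dir s t : F s -> F t -> exists2 u, F u & ext s u /\ ext t u.
    move=> Fs Ft; have [/asboolP e|/asboolP e] := Ftot _ _ Fs Ft.
      by exists t => //; split=> //; split.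
    by exists s => //; split=> //; split.
  (* The union of the maps in the chain: any member whose square contains [p] gives the same value,
     by [dir]. *)
  pose f p := xget point [set z | exists2 s, F s &
    ((sval s).1 `*` (sval s).1) p /\ z = (sval s).2 p].
  have fE s x y : F s -> (sval s).1 x -> (sval s).1 y ->
      f (x, y) = (sval s).2 (x, y).
    move=> Fs sx sy; rewrite /f; case: xgetP => [_ -> [t Ft [[/= tx ty] ->]]|].
      have [u _ [[_ su] [_ tu]]] := dir _ _ Fs Ft.
      by rewrite -su// -tu.
    by move=> /(_ ((sval s).2 (x, y)))[]; exists s.
  have AP x y : A x -> A y -> exists2 s, F s & (sval s).1 x /\ (sval s).1 y.
    move=> [s Fs sx] [t Ft ty]; have [u Fu [[su _] [tu _]]] := dir _ _ Fs Ft.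
    by exists u => //; split; [exact: su|exact: tu].
  have Af : infinite_set A /\ square_inj A f.
    split.
      apply: sub_infinite_set (svalP s0).1 => x s0x; by exists s0.
    split=> [[x y] [/= Ax Ay]|[x y] [x' y']].
      have [s Fs [sx sy]] := AP _ _ Ax Ay; rewrite (fE s)//.
      by exists s => //; apply: (svalP s).2.1.
    move=> /set_mem[/= Ax Ay] /set_mem[/= Ax' Ay'].
    have [s Fs [sx sy]] := AP _ _ Ax Ay.
    have [t Ft [tx' ty']] := AP _ _ Ax' Ay'.
    (* All four coordinates lie in one member [u], whose injectivity applies. *)
    have [u Fu [[su _] [tu _]]] := dir _ _ Fs Ft.
    rewrite !(fE u); try by [|exact: su|exact: tu].
    by apply: (svalP u).2.2; rewrite inE; split; by [exact: su|exact: tu].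
  exists (exist _ (A, f) Af) => s Fs; apply/asboolP; split=> /=.
    by move=> x sx; exists s.
  by move=> x y; apply: fE.
(* Maximality in a preorder makes [(A, f)] extend its own extension [(C, f')], so [C] would be
   contained in [A]. *)
- exists A, f; split=> // C f' [AC CA] Cf' ff'; apply: CA.
  have Cinf : infinite_set C by apply: (sub_infinite_set AC Ainf).
  by have /asboolP[] : `[< ext (exist _ (C, f') (conj Cinf Cf'))
    (exist _ (A, f) (conj Ainf Af)) >] by apply/Amax/asboolP.
Qed.

Theorem infinite_card_le_prod {T : Type} :
  infinite_set [set: T] -> [set: T * T] #<= [set: T].
Proof.
elim/Ppointed: T => T; first by move=> Tinf; case: (infinite_setN0 Tinf).
move=> /maximal_square_inj[A [f [Ainf Af Amax]]].
have [AcA|AAc] := card_le_total (~` A) A; last first.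
  have [C [f' [AC Cf' ff']]] := square_inj_extend Af Ainf AAc.
  by case: (Amax _ _ AC Cf').
have : [set: T] #<= A by apply: (square_inj_absorb Af Ainf); rewrite setTD.
move=> /pcard_leP/injfunPex[h hA hinj].
have {}hA x : A (h x) by exact: hA.
have {}hinj : injective h by move=> x y /hinj; apply; rewrite inE.
apply/pcard_injP; exists (fun p => f (h p.1, h p.2)) => -[x y] [x' y'] _ _ /=.
by move=> /(square_inj_eq Af)[]// /hinj-> /hinj->.
Qed.

(** * Regular elements and total fractions *)

Local Open Scope ring_scope.

Lemma finite_non_zero_divisor_inv {R : comPzRingType} {s : R} :
  finite_set [set: R] -> s \in @non_zero_divisor R -> exists t, s * t = 1.
Proof.
move=> Rfin /[dup] sS /non_zero_divisorP sreg.
have [sinj|] := pselect (injective (fun n => s ^+ n)).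
  by case/finite_setPn: Rfin; apply: injective_card_le sinj.
move=> /existsNP[m /existsNP[n /not_implyP[+ /eqP mn]]].
wlog lt_mn : m n mn / (m < n)%N.
  move=> wl e; move: (mn); rewrite neq_ltn => /orP[] lt; first exact: (wl m n).
  by apply: (wl n m) => //; rewrite eq_sym.
have {}sreg k y : s ^+ k * y = 0 -> y = 0.
  by elim: k => [|k IH]; rewrite ?mul1r// exprS -mulrA => /sreg.
(* From [s ^+ m = s ^+ n] with [m < n], cancel the regular factor [s ^+ m] in
   [s ^+ m * (1 - s ^+ (n - m)) = 0]. *)
move=> e; exists (s ^+ (n - m.+1)); apply/esym/eqP; rewrite -subr_eq0; apply/eqP.
apply: (sreg m); rewrite mulrBr mulr1 -exprS -exprD subnSK// subnKC ?(ltnW lt_mn)//.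
by rewrite e subrr.
Qed.

Theorem theorem4p12 (R : comPzRingType) :
  [set: R] #= [set: total_fractions R].
Proof.
apply: Cantor_Bernstein.
  apply: (@injective_card_le _ _ (@Localization.tofrac R (@non_zero_divisor R))).
  (* Equal images give [t * (x - y) = 0] with [t] regular. *)
  move=> x y /Localization.frac_eq[t /non_zero_divisorP treg /treg/eqP].
  by rewrite !mulr1 subr_eq0 => /eqP.
have [Rfin|Rinf] := pselect (finite_set [set: R]).
  apply: card_le_trans (card_image_le
    (@Localization.tofrac R (@non_zero_divisor R)) [set: R]).
  apply: subset_card_le => a _; have [r [s [sS ->]]] := Localization.fracP a.
  have [t st] := finite_non_zero_divisor_inv Rfin sS.
  (* As [t] inverts [s], the fraction [r / s] is the image of [r * t]. *)
  exists (r * t) => //; apply/Localization.frac_eq; exists 1; first exact: rpred1.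
  by rewrite mul1r mulr1 -mulrA (mulrC t) st mulr1 subrr.
apply: card_le_trans (infinite_card_le_prod Rinf).
(* [repr] chooses one numerator and denominator for each fraction. *)
apply: (@injective_card_le _ _ (fun a : total_fractions R =>
  (Localization.num (repr a), Localization.den (repr a)))).
move=> a b [enum eden]; rewrite -[a]reprK -[b]reprK.
by apply: Localization.pi_cross; rewrite enum eden.
Qed.
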